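(* Let $k\ge 2$ be an integer that is not a perfect cube, and let $\alpha=\sqrt[3]{k}$ have regular continued fraction coefficients $b_0,b_1,b_2,\ldots$ and convergents $p_n/q_n$ ($n\ge 0$). Let $\varepsilon>0$ and suppose that $K_\varepsilon>0$ is a constant such that $c<K_\varepsilon\,\mathrm{rad}(abc)^{1+\varepsilon}$ for all triples $(a,b,c)$ of coprime positive integers with $a+b=c$. Put $$\varepsilon_{\mathrm{Roth}}=\frac{3\varepsilon}{1+\varepsilon}.$$ Then there is a constant $C>0$ such that $$b_{n+1}\le \frac{q_n^{\varepsilon_{\mathrm{Roth}}}}{C}\quad\text{for all } n\ge 0,$$ and $$\frac1C\le K_\varepsilon^{\frac{1}{1+\varepsilon}}\cdot 3k\cdot\left(\frac{p_1}{q_1}\right)^{\frac{3\varepsilon}{1+\varepsilon}}.$$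
   Context: For a positive integer $m$, $\mathrm{rad}(m)$ is the product of the distinct prime factors of $m$. The regular continued fraction of $\alpha$ is $\alpha=[b_0;b_1,b_2,\ldots]$ with $b_0=\lfloor\alpha\rfloor$, and its convergents in lowest terms are $p_n/q_n=[b_0;b_1,\ldots,b_n]$ with $q_n>0$. Thus $p_0/q_0=b_0$, and $p_1/q_1$ is the largest convergent (for example $4/3$ when $k=2$). The inequality $b_{n+1}\le q_n^{\varepsilon_{\mathrm{Roth}}}/C$ is the continued-fraction form of Roth's inequality $|\alpha-p/q|>C/q^{2+\varepsilon_{\mathrm{Roth}}}$, and $C$ is called the Roth constant. *)

(* Defs.v *)
From HB Require Import structures.
From mathcomp Require Import all_boot all_order all_algebra.
From mathcomp Require Import all_classical all_reals all_analysis.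
Set Implicit Arguments.
Unset Strict Implicit.
Unset Printing Implicit Defensive.
Import Order.TTheory GRing.Theory Num.Theory.
Local Open Scope ring_scope.

Definition nat_rad (m : nat) : nat := (\prod_(p <- primes m) p)%N.

(* Complete quotients: x_0 = x and x_(n+1) = 1 / (x_n - floor x_n). For
   irrational x the denominators never vanish; for rational x the expansion
   terminates, and the values past its end are junk coming from 0^-1 = 0. *)
Fixpoint complete_quotient (R : realType) (x : R) (n : nat) : R :=
  if n is m.+1 then
    (complete_quotient x m - (Num.floor (complete_quotient x m))%:~R)^-1
  else x.

Definition cf_coef (R : realType) (x : R) (n : nat) : int :=
  Num.floor (complete_quotient x n).

(* [b 0; b 1, ..., b n], i.e. n + 1 coefficients *)
Fixpoint cf_value (b : nat -> int) (n : nat) : rat :=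
  if n is m.+1 then (b 0%N)%:~R + (cf_value (fun i => b i.+1) m)^-1
  else (b 0%N)%:~R.

Definition convergent (R : realType) (x : R) (n : nat) : rat :=
  cf_value (cf_coef x) n.

(* numq and denq are coprime and denq is positive. *)
Definition cf_num (R : realType) (x : R) (n : nat) : int :=
  numq (convergent x n).

Definition cf_den (R : realType) (x : R) (n : nat) : int :=
  denq (convergent x n).

(* Main.v *)
Require Import Defs.
From mathcomp Require Import all_boot all_order all_algebra.
From mathcomp Require Import all_classical all_reals all_analysis.
From mathcomp Require Import ring lra.
Set Implicit Arguments.
Unset Strict Implicit.
Unset Printing Implicit Defensive.
Import Order.TTheory GRing.Theory Num.Theory.
Local Open Scope ring_scope.

(** The idea: a convergent p/q very close to the cube root [alpha] of [k] makes
    [d = |p^3 - k q^3|] small, while [d] is the third member of an abc triple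
    whose other members [p^3] and [k q^3] have a small radical.

    Let [y = max (p, alpha q)], so that [y^3 = max (p^3, k q^3)].  Every prime
    dividing [p^3 * (k q^3)] divides [k p q], so the abc inequality bounds [y^3]
    by [K (k p q d)^(1 + eps)].  The triple need not be coprime; dividing it by
    its gcd [g] and multiplying back costs [g / g^(1 + eps) <= 1]
    ([abc_scaled]).  On the other hand
    [d <= 3 y^2 |q alpha - p|], and the theory of continued fractions gives
    [b_(n+1) q |q alpha - p| <= 1] ([cf_approx]).  Multiplying the two and using
    [p <= y] yields ([quotient_le_of_abc])
    [[
      b_(n+1) <= 3 k K^(1 / (1 + eps)) y^(3 - 3 / (1 + eps)),
    ]]
    where the exponent of [y] is the Roth exponent [3 eps / (1 + eps)].
    Finally [y / q] is [p/q] or [alpha], and both are at most [p_1/q_1]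
    ([convergent_le1], [le_convergent1]); so the bound on [1/C] can be attained.

    Convergents are handled without the three-term recurrence.  Peeling off the
    first coefficient replaces [x] by [x_1 = 1 / (x - floor x)], and
    [p_(n+1)(x) = floor x * p_n(x_1) + q_n(x_1)], [q_(n+1)(x) = p_n(x_1)]
    ([cf_num_denS]).  An induction over all irrational [x] then shows that
    [|q_n x - p_n|] is the inverse of [x_1 ... x_(n+1)] ([cf_defect]) and that
    [q_n <= x_1 ... x_n] ([cf_den_le]). *)

(** * Radicals *)

Lemma prod_primes_dvdn (s : seq nat) (m : nat) :
  uniq s -> all prime s -> {in s, forall r, r %| m}%N ->
  (\prod_(r <- s) r %| m)%N.
Proof.
elim: s => [|r s IHs] /=; first by rewrite big_nil dvd1n.
move=> /andP[rNs us] /andP[pr prs] dvs; rewrite big_cons Gauss_dvd.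
  by rewrite dvs ?mem_head// IHs// => t ts; apply: dvs; rewrite inE ts orbT.
rewrite prime_coprime// Euclid_dvd_prod// big_has; apply/hasPn => t ts.
rewrite dvdn_prime2 ?(allP prs t ts)//.
by apply: contraNneq rNs => rt; rewrite rt.
Qed.

Lemma nat_rad_dvdn (m n : nat) :
  (forall r, prime r -> (r %| m)%N -> (r %| n)%N) -> (nat_rad m %| n)%N.
Proof.
move=> H; apply: prod_primes_dvdn; first exact: primes_uniq.
  by apply/allP => r; rewrite mem_primes => /andP[].
by move=> r; rewrite mem_primes => /and3P[pr _ /(H _ pr)].
Qed.

(** * Continued fractions of irrational numbers *)

Section ContinuedFraction.
Variable R : realType.
Implicit Types x : R.

Definition cf_tail x : R := (x - (Num.floor x)%:~R)^-1.

(** The definition iterates the Gauss map from the outside; iterating it from the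
    inside is what makes induction over [x] possible. *)
Lemma complete_quotientS x n :
  complete_quotient x n.+1 = complete_quotient (cf_tail x) n.
Proof. by elim: n => [//|n /= ->]. Qed.

Lemma prod_complete_quotientS x n :
  \prod_(i < n.+1) complete_quotient x i
  = x * \prod_(i < n) complete_quotient (cf_tail x) i.
Proof.
by rewrite big_ord_recl; under eq_bigr => i _ do rewrite complete_quotientS.
Qed.

Lemma convergentS x n :
  convergent x n.+1 = (Num.floor x)%:~R + (convergent (cf_tail x) n)^-1.
Proof.
rewrite /convergent /=; congr (_ + (cf_value _ n)^-1).
by apply/funext => i; rewrite /cf_coef complete_quotientS.
Qed.

Lemma irrational_frac x : irrational x -> 0 < x - (Num.floor x)%:~R < 1.
Proof.
move=> irr; have /andP[l u] := floor_itv x.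
rewrite intrD1 in u; rewrite subr_gt0 ltrBlDl u andbT lt_neqAle l andbT.
apply/eqP => e; apply: irr; exists (Num.floor x)%:~R => //.
by rewrite ratr_int.
Qed.

Lemma cf_tail_irrational x : irrational x -> irrational (cf_tail x).
Proof.
move=> irr [r _ e]; apply: irr; exists ((Num.floor x)%:~R + r^-1) => //.
by rewrite rmorphD fmorphV /= ratr_int e invrK addrC subrK.
Qed.

Lemma cf_tail_gt1 x : irrational x -> 1 < cf_tail x.
Proof. by move=> /irrational_frac H; rewrite invf_gt1//; case/andP: H. Qed.

Lemma cf_tailE x : irrational x -> (x - (Num.floor x)%:~R) * cf_tail x = 1.
Proof. by move=> /irrational_frac/andP[f0 _]; rewrite mulfV// gt_eqF. Qed.

Lemma floor_ge1 x : 1 < x -> (1 : rat) <= (Num.floor x)%:~R.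
Proof. by move=> x1; rewrite ler1z -gtz0_ge1 floor_gt0 ltW. Qed.

Lemma convergent_ge_floor x n : irrational x -> 1 < x ->
  (Num.floor x)%:~R <= convergent x n.
Proof.
elim: n x => [//|n IHn] x irr x1.
rewrite convergentS lerDl invr_ge0.
apply: le_trans (IHn _ (cf_tail_irrational irr) (cf_tail_gt1 irr)).
exact: le_trans (floor_ge1 (cf_tail_gt1 irr)).
Qed.

Lemma convergent_gt0 x n : irrational x -> 1 < x -> 0 < convergent x n.
Proof.
move=> irr x1; apply: lt_le_trans (convergent_ge_floor n irr x1).
exact: lt_le_trans (floor_ge1 x1).
Qed.

Lemma cf_num_gt0 x n : irrational x -> 1 < x -> 0 < cf_num x n.
Proof. by move=> irr x1; rewrite numq_gt0 convergent_gt0. Qed.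

(** The fraction obtained by adding [floor x] to the inverse of [P/Q] is
    [(floor x * P + Q) / P], which is already in lowest terms. *)
Lemma cf_num_denS x n : irrational x ->
  cf_num x n.+1 = Num.floor x * cf_num (cf_tail x) n + cf_den (cf_tail x) n
  /\ cf_den x n.+1 = cf_num (cf_tail x) n.
Proof.
move=> irr; have P0 := cf_num_gt0 n (cf_tail_irrational irr) (cf_tail_gt1 irr).
rewrite /cf_num /cf_den convergentS.
rewrite /cf_num in P0; set r := convergent _ n in P0 *.
have -> : (Num.floor x)%:~R + r^-1
    = (Num.floor x * numq r + denq r)%:~R / (numq r)%:~R.
  rewrite -{1}[r]divq_num_den invf_div intrD intrM mulrDl mulfK//.
  by rewrite intr_eq0 gt_eqF.
have cop : coprime `|Num.floor x * numq r + denq r| `|numq r|.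
  rewrite -coprimezE /coprimez gcdzC gcdzMDl -/(coprimez _ _) coprimezE.
  exact: coprime_num_den.
by rewrite coprimeq_num// coprimeq_den// gtr0_sg// mul1r gt_eqF// gtr0_norm.
Qed.

Lemma cf_num0 x : cf_num x 0 = Num.floor x.
Proof. exact: numq_int. Qed.

Lemma cf_den0 x : cf_den x 0 = 1.
Proof. exact: denq_int. Qed.

(** One peeling step divides the defect by the complete quotient [x_1], since
    [P x - (floor x * P + Q) = P / x_1 - Q]. *)
Lemma cf_defect x n : irrational x ->
  `|(cf_den x n)%:~R * x - (cf_num x n)%:~R|
    * (\prod_(i < n.+1) complete_quotient x i.+1) = 1.
Proof.
elim: n x => [|n IHn] x irr.
  have /andP[f0 _] := irrational_frac irr.
  by rewrite cf_num0 cf_den0 mul1r big_ord1 gtr0_norm//=; apply: cf_tailE.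
have [-> ->] := cf_num_denS n irr; have t1 := cf_tail_gt1 irr.
rewrite big_ord_recl.
under eq_bigr => i _ do rewrite complete_quotientS.
rewrite -[RHS](IHn _ (cf_tail_irrational irr)) mulrA; congr (_ * _).
rewrite complete_quotientS/= -[X in _ * X = _]gtr0_norm ?(lt_trans _ t1)//.
rewrite -normrM distrC; congr `|_|; rewrite intrD intrM.
set P := (cf_num _ _)%:~R; set Q := (cf_den _ _)%:~R; set b := _%:~R.
have -> : (P * x - (b * P + Q)) * cf_tail x = P * ((x - b) * cf_tail x) - Q * cf_tail x.
  by ring.
by rewrite cf_tailE// mulr1.
Qed.

(** The product [x x_1 ... x_n] satisfies the same two-step recurrence as [p_n],
    with nonnegative coefficients, because [(x - floor x) x_1 = 1]; hence the
    inequality propagates from [n = 0] and [n = 1]. *)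
Lemma cf_num_le x n : irrational x -> 0 <= x ->
  (cf_num x n)%:~R <= \prod_(i < n.+1) complete_quotient x i.
Proof.
have [m] := ubnP n; elim: m n x => // m IHm [|[|n]] x nm irr x0.
- by rewrite cf_num0 big_ord1 floor_le.
- have [-> _] := cf_num_denS 0 irr.
  rewrite cf_num0 cf_den0 big_ord_recr big_ord1 intrD intrM complete_quotientS/=.
  have := cf_tailE irr; have := floor_le (cf_tail x).
  have : 0 <= (Num.floor x)%:~R :> R by rewrite ler0z floor_ge0.
  nra.
have irr1 := cf_tail_irrational irr; have t1 := cf_tail_gt1 irr.
have [-> _] := cf_num_denS n.+1 irr; have [_ ->] := cf_num_denS n irr1.
have H1 := IHm n.+1 (cf_tail x) nm irr1 (ltW (lt_trans ltr01 t1)).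
have H2 := IHm n (cf_tail (cf_tail x)) (ltnW nm) (cf_tail_irrational irr1)
             (ltW (lt_trans ltr01 (cf_tail_gt1 irr1))).
have b0 : 0 <= (Num.floor x)%:~R :> R by rewrite ler0z floor_ge0.
rewrite prod_complete_quotientS in H1; rewrite 2!prod_complete_quotientS intrD intrM.
move: H1 H2 b0 (cf_tailE irr).
set P := \prod_(i < _) _; set b := (Num.floor x)%:~R => H1 H2 b0 e.
have -> : x * (cf_tail x * P) = b * (cf_tail x * P) + (x - b) * cf_tail x * P by ring.
by rewrite e mul1r lerD// ler_wpM2l.
Qed.

Lemma cf_den_le x n : irrational x ->
  (cf_den x n)%:~R <= \prod_(i < n) complete_quotient x i.+1.
Proof.
case: n => [|n] irr; first by rewrite cf_den0 big_ord0.
have [_ ->] := cf_num_denS n irr.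
under eq_bigr => i _ do rewrite complete_quotientS.
apply: cf_num_le (cf_tail_irrational irr) _.
exact: ltW (lt_trans ltr01 (cf_tail_gt1 irr)).
Qed.

Lemma cf_coef_ge0 x n : irrational x -> 0 <= x -> 0 <= cf_coef x n.
Proof.
elim: n x => [|n IHn] x irr x0; first by rewrite floor_ge0.
rewrite /cf_coef complete_quotientS; apply: IHn (cf_tail_irrational irr) _.
exact: ltW (lt_trans ltr01 (cf_tail_gt1 irr)).
Qed.

(** The usual [|x - p_n/q_n| <= 1 / (b_(n+1) q_n^2)], without divisions: by
    [cf_defect] it says that [b_(n+1) q_n <= x_1 ... x_(n+1)]. *)
Lemma cf_approx x n : irrational x ->
  (cf_coef x n.+1)%:~R * (cf_den x n)%:~R
    * `|(cf_den x n)%:~R * x - (cf_num x n)%:~R| <= 1 :> R.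
Proof.
move=> irr; rewrite -[leRHS](cf_defect n irr) [leRHS]mulrC ler_wpM2r//.
rewrite big_ord_recr/= mulrC ler_pM ?cf_den_le// ?floor_le//.
  by rewrite ler0z denq_ge0.
rewrite ler0z /cf_coef complete_quotientS.
exact: cf_coef_ge0 (cf_tail_irrational irr)
         (ltW (lt_trans ltr01 (cf_tail_gt1 irr))).
Qed.

(** The tail of a later convergent is at least its integer part [b_1], and it
    enters the convergent through its inverse. *)
Lemma convergent_le1 x n : irrational x -> convergent x n <= convergent x 1.
Proof.
move=> irr; have t1 := cf_tail_gt1 irr; rewrite [leRHS]convergentS.
have c0 : 0 < convergent (cf_tail x) 0.
  exact: convergent_gt0 (cf_tail_irrational irr) t1.
case: n => [|n]; first by rewrite lerDl invr_ge0 ltW.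
rewrite convergentS lerD2l lef_pV2 ?posrE//.
  exact: convergent_ge_floor (cf_tail_irrational irr) t1.
exact: convergent_gt0 (cf_tail_irrational irr) t1.
Qed.

Lemma le_convergent1 x : irrational x -> x <= ratr (convergent x 1).
Proof.
move=> irr; have t1 := cf_tail_gt1 irr.
rewrite convergentS rmorphD fmorphV /= !ratr_int -lerBlDl.
rewrite -[x - _]invrK lef_pV2 ?posrE ?floor_le//.
  exact: lt_trans t1.
by rewrite ltr0z floor_gt0 ltW.
Qed.

Lemma ratr_convergent x n :
  ratr (convergent x n) = (cf_num x n)%:~R / (cf_den x n)%:~R :> R.
Proof. by []. Qed.

End ContinuedFraction.

(** * Bounding a partial quotient by the abc inequality *)

Section ABC.
Variables (R : realType) (eps K : R).
Hypotheses (heps : 0 < eps) (hK : 0 < K).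
Hypothesis habc : forall a b c : nat, (0 < a)%N -> (0 < b)%N -> (0 < c)%N ->
  gcdn (gcdn a b) c = 1%N -> (a + b)%N = c ->
  c%:R < K * (nat_rad (a * b * c)%N)%:R `^ (1 + eps).

(** The abc inequality for a triple that may have a common factor.  Dividing by
    the gcd [g] turns [d] into [d / g], whose radical is at most [d / g]; since
    [1 <= 1 + eps], the factor [g] gained inside the power outweighs the factor
    [g] lost outside.  [N] stands for any multiple of the primes of the two
    members that are not [d]. *)
Lemma abc_scaled (a d N : nat) : (0 < a)%N -> (0 < d)%N -> (0 < N)%N ->
  (forall r, prime r -> (r %| a * (a + d))%N -> (r %| N)%N) ->
  (a + d)%:R <= K * (N * d)%:R `^ (1 + eps).
Proof.
move=> a0 d0 N0 HN; set g := gcdn a d.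
have g0 : (0 < g)%N by rewrite gcdn_gt0 a0.
have [a' aE] := dvdnP (dvdn_gcdl a d); have [d' dE] := dvdnP (dvdn_gcdr a d).
rewrite -/g in aE dE.
have a'0 : (0 < a')%N by case: a' aE a0 => // ->.
have d'0 : (0 < d')%N by case: d' dE d0 => // ->.
have cop : gcdn a' d' = 1%N.
  by apply/eqP; rewrite -(eqn_pmul2r g0) muln_gcdl -aE -dE mul1n.
have := @habc a' d' (a' + d')%N a'0 d'0.
rewrite addn_gt0 a'0 cop gcd1n => /(_ isT erefl erefl) lt_abc.
have rad_dvd : (nat_rad (a' * d' * (a' + d')) %| N * d')%N.
  apply: nat_rad_dvdn => r pr.
  rewrite !Euclid_dvdM// => /orP[/orP[ra|->]|rc]; last 2 first.
  - by rewrite orbT.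
  - by rewrite HN// aE dE -mulnDl !Euclid_dvdM// rc !orbT.
  - by rewrite HN// aE dE -mulnDl !Euclid_dvdM// ra.
have rad_le : (nat_rad (a' * d' * (a' + d')))%:R <= (N * d')%:R :> R.
  by rewrite ler_nat dvdn_leq// muln_gt0 N0.
rewrite aE dE -mulnDl natrM mulrC.
apply: (@le_trans _ _ (g%:R * (K * (N * d')%:R `^ (1 + eps)))).
  rewrite ler_wpM2l ?ler0n// (le_trans (ltW lt_abc))// ler_wpM2l ?(ltW hK)//.
  by rewrite ge0_ler_powR ?nnegrE ?ler0n// addr_ge0 ?ltW.
rewrite mulrCA ler_wpM2l ?(ltW hK)//.
have -> : (N * (d' * g) = g * (N * d'))%N by rewrite mulnA mulnC.
rewrite [in leRHS]natrM.
by rewrite le1r_powRZ ?ler0n ?ler1n// lerDl ltW.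
Qed.

Let s := 1 / (1 + eps).
Let epsRoth := 3%:R * eps / (1 + eps).

Lemma abc_root (a d N : nat) : (0 < a)%N -> (0 < d)%N -> (0 < N)%N ->
  (forall r, prime r -> (r %| a * (a + d))%N -> (r %| N)%N) ->
  (a + d)%:R `^ s <= K `^ s * (N * d)%:R.
Proof.
move=> a0 d0 N0 HN; have e1 : 0 < 1 + eps by rewrite addr_gt0.
have root z : 0 <= z -> (z `^ (1 + eps)) `^ s = z :> R.
  by move=> z0; rewrite -powRrM mulrCA divff ?mulr1 ?powRr1 ?gt_eqF.
rewrite -[X in _ * X]root ?ler0n// -powRM ?powR_ge0 ?(ltW hK)//.
apply: ge0_ler_powR; rewrite ?nnegrE ?ler0n ?mulr_ge0 ?powR_ge0 ?(ltW hK)//.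
  by rewrite invr_ge0 ltW.
exact: abc_scaled.
Qed.

(** Meant for [x^3] and [y^3] being the integers [p^3] and [k q^3] in increasing
    order, with [B] the partial quotient following [p/q].  Taking [y] to be the
    larger keeps both [y^3 - x^3 <= 3 (y - x) y^2] and the abc inequality for
    the largest member of the triple. *)
Lemma quotient_le_of_abc (k p q a c : nat) (x y B : R) :
  (0 < k)%N -> (0 < p)%N -> (0 < q)%N -> (0 < a)%N -> (a < c)%N ->
  (forall r, prime r -> (r %| a * c)%N -> (r %| k * p * q)%N) ->
  0 < x -> 0 < y -> x ^+ 3 = a%:R -> y ^+ 3 = c%:R -> p%:R <= y -> 0 <= B ->
  B * q%:R * `|y - x| <= 1 ->
  B <= K `^ s * (3%:R * k%:R) * y `^ epsRoth.
Proof.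
move=> k0 p0 q0 a0 ac Hr x0 y0 xE yE py B0 HB.
have e1 : 0 < 1 + eps by rewrite addr_gt0.
have xy : x < y.
  by rewrite -(@ltr_pXn2r _ 3) ?nnegrE ?(ltW x0) ?(ltW y0)// xE yE ltr_nat.
have /= := @abc_root a (c - a)%N (k * p * q)%N a0.
rewrite subnKC ?(ltnW ac)// subn_gt0 ac !muln_gt0 k0 p0 q0 => /(_ isT isT Hr).
rewrite natrM natrB ?(ltnW ac)// -yE -xE !natrM => H.
have Y0 : 0 < (y ^+ 3) `^ s by rewrite powR_gt0// exprn_gt0.
(* The Roth exponent is what remains of the exponent 3 after the abc root. *)
have yy : y ^+ 3 = (y ^+ 3) `^ s * y `^ epsRoth.
  rewrite -!powR_mulrn ?(ltW y0)// -powRrM -powRD ?(gt_eqF y0) ?implybT//.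
  congr (_ `^ _); rewrite /s /epsRoth; field; exact: lt0r_neq0.
rewrite -(ler_pM2l Y0) mulrCA -yy.
have Ks : 0 <= K `^ s by exact: powR_ge0.
have k0' : 0 <= k%:R :> R by exact: ler0n.
have p0' : 0 <= p%:R :> R by exact: ler0n.
have q0' : 0 <= q%:R :> R by exact: ler0n.
rewrite gtr0_norm ?subr_gt0// in HB.
have cubes : y ^+ 3 - x ^+ 3 <= (y - x) * (3%:R * y ^+ 2).
  have -> : y ^+ 3 - x ^+ 3 = (y - x) * (y ^+ 2 + x * y + x ^+ 2) by ring.
  by rewrite ler_wpM2l ?subr_ge0 ?(ltW xy)//; nra.
apply: (@le_trans _ _ (K `^ s * (3%:R * k%:R) * (p%:R * y ^+ 2) * (B * q%:R * (y - x)))).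
  rewrite mulrC; apply: le_trans (ler_wpM2l B0 H) _.
  have -> : K `^ s * (3%:R * k%:R) * (p%:R * y ^+ 2) * (B * q%:R * (y - x))
    = B * (K `^ s * (k%:R * p%:R * q%:R * ((y - x) * (3%:R * y ^+ 2)))) by ring.
  by rewrite ler_wpM2l// ler_wpM2l// ler_wpM2l// !mulr_ge0.
rewrite -[leRHS]mulr1 ler_pM// ?mulr_ge0 ?exprn_ge0 ?subr_ge0 ?(ltW xy) ?(ltW y0)//.
by rewrite ler_wpM2l ?mulr_ge0// exprS ler_wpM2r// sqr_ge0.
Qed.

End ABC.

(** * Cube roots *)

Lemma cube_ratio (k p q : nat) :
  (0 < q)%N -> (p ^ 3 = k * q ^ 3)%N -> exists m : nat, k = (m ^ 3)%N.
Proof.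
move=> q0 e; have : (q ^ 3 %| p ^ 3)%N by rewrite e dvdn_mull.
rewrite dvdn_pexp2r// => /dvdnP[m pE]; exists m; move: e.
by rewrite pE expnMn => /eqP; rewrite eqn_pmul2r ?expn_gt0 ?q0// => /eqP.
Qed.

Lemma cbrtK (R : realType) (k : nat) : (k%:R `^ (3%:R^-1)) ^+ 3 = k%:R :> R.
Proof.
by rewrite -powR_mulrn ?powR_ge0// -powRrM mulVf ?powRr1 ?ler0n// pnatr_eq0.
Qed.

Lemma cbrt_irrational (R : realType) (k : nat) :
  (~ exists m : nat, k = (m ^ 3)%N) -> irrational (k%:R `^ (3%:R^-1) : R).
Proof.
move=> hcube [r _ e]; apply: hcube.
apply: (@cube_ratio k `|numq r|%N `|denq r|%N).
  by rewrite absz_gt0 denq_neq0.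
have : (numq r ^+ 3)%:~R = k%:R * (denq r ^+ 3)%:~R :> R.
  rewrite -(cbrtK R k) -e /ratr.
  by rewrite !rmorphXn /= -exprMn divfK// intr_eq0 denq_neq0.
move=> /eqP; rewrite -[k%:R]/(k%:~R) -intrM eqr_int => /eqP/(congr1 absz).
by rewrite !(abszX, abszM).
Qed.

Theorem mainTheorem1 (R : realType) (k : nat) (hk : (2 <= k)%N)
    (hcube : ~ exists m : nat, k = (m ^ 3)%N)
    (eps K : R) (heps : 0 < eps) (hK : 0 < K)
    (habc : forall a b c : nat, (0 < a)%N -> (0 < b)%N -> (0 < c)%N ->
      gcdn (gcdn a b) c = 1%N -> (a + b)%N = c ->
      c%:R < K * (nat_rad (a * b * c)%N)%:R `^ (1 + eps)) :
  let alpha : R := k%:R `^ (3%:R^-1) in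
  let b := cf_coef alpha in
  let p := cf_num alpha in
  let q := cf_den alpha in
  let epsRoth := 3%:R * eps / (1 + eps) in
  exists C : R,
    [/\ 0 < C,
        forall n : nat, (b n.+1)%:~R <= (q n)%:~R `^ epsRoth / C
      & C^-1 <= K `^ (1 / (1 + eps)) * (3%:R * k%:R)
                * ((p 1%N)%:~R / (q 1%N)%:~R) `^ (3%:R * eps / (1 + eps))].
Proof.
move=> alpha b p q epsRoth.
have irr : irrational alpha by exact: cbrt_irrational.
have a3 : alpha ^+ 3 = k%:R by exact: cbrtK.
have k0 : (0 < k)%N by exact: ltnW.
have a1 : 1 < alpha.
  by rewrite -(@ltr_pXn2r _ 3) ?nnegrE ?powR_ge0// expr1n a3 ltr1n.
have a0 : 0 < alpha by exact: lt_trans a1.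
have p0 n : 0 < p n by exact: cf_num_gt0.
have q0 n : 0 < q n by exact: denq_gt0.
have q0R n : 0 < (q n)%:~R :> R by rewrite ltr0z.
have c0 : 0 < (p 1%N)%:~R / (q 1%N)%:~R :> R by rewrite divr_gt0// ltr0z.
set M := K `^ _ * _ * _.
have M0 : 0 < M by rewrite !mulr_gt0 ?powR_gt0// ltr0n.
(* The constant is the extreme one: the required bound on C^-1 is an equality. *)
exists M^-1; split; [by rewrite invr_gt0| |by rewrite invrK].
move=> n; rewrite invrK mulrC /M -[leRHS]mulrA -powRM ?(ltW c0) ?(ltW (q0R n))//.
have b0 : 0 <= (b n.+1)%:~R :> R by rewrite ler0z cf_coef_ge0// ltW.
have := cf_approx n irr; rewrite -/(b n.+1) -/(p n) -/(q n).
have [P pE] : exists P : nat, p n = P by exists `|p n|%N; rewrite gez0_abs ?ltW.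
have [Q qE] : exists Q : nat, q n = Q by exists `|q n|%N; rewrite gez0_abs ?ltW.
have := p0 n; have := q0 n; have := q0R n.
have aq : alpha * (q n)%:~R <= (p 1%N)%:~R / (q 1%N)%:~R * (q n)%:~R.
  by rewrite ler_pM2r// -ratr_convergent le_convergent1.
have pq : (p n)%:~R <= (p 1%N)%:~R / (q 1%N)%:~R * (q n)%:~R :> R.
  by rewrite -ler_pdivrMr// -!ratr_convergent ler_rat convergent_le1.
move: aq pq; rewrite pE qE !ltz_nat -!pmulrn => aq pq QR Q0 P0 HB.
have P0R : 0 < P%:R :> R by rewrite ltr0n.
have e0 : 0 <= epsRoth by rewrite divr_ge0 ?mulr_ge0 ?addr_ge0 ?ltW.
have y3 : (alpha * Q%:R) ^+ 3 = (k * Q ^ 3)%:R by rewrite exprMn a3 natrM natrX.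
have le_pow y : 0 <= y -> y <= (p 1%N)%:~R / (q 1%N)%:~R * Q%:R ->
    K `^ (1 / (1 + eps)) * (3%:R * k%:R) * y `^ epsRoth <=
    K `^ (1 / (1 + eps)) * (3%:R * k%:R) *
      ((p 1%N)%:~R / (q 1%N)%:~R * Q%:R) `^ epsRoth.
  move=> y0 yle; rewrite ler_wpM2l ?mulr_ge0 ?powR_ge0//.
  by rewrite ge0_ler_powR ?nnegrE// (le_trans y0).
have dvd r : prime r -> (r %| P ^ 3 * (k * Q ^ 3))%N -> (r %| k * P * Q)%N.
  move=> pr; rewrite !(Euclid_dvdM, Euclid_dvdX)//= !andbT.
  by case/or3P => ->; rewrite ?orbT.
have [lt|gt|eq] := ltngtP (P ^ 3)%N (k * Q ^ 3)%N.
(* p^3 < k q^3: the convergent lies below alpha, and y = alpha q. *)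
- apply: le_trans (le_pow _ (ltW (mulr_gt0 a0 QR)) aq).
  apply: (quotient_le_of_abc heps hK habc k0 P0 Q0 _ lt dvd P0R) => //.
  + by rewrite expn_gt0 P0.
  + by rewrite mulr_gt0.
  + by rewrite natrX.
  + rewrite -(@ler_pXn2r _ 3) ?nnegrE ?mulr_ge0 ?(ltW a0)// y3 -natrX ler_nat.
    exact: ltnW.
  + by rewrite (mulrC alpha).
(* k q^3 < p^3: the convergent lies above alpha, and y = p. *)
- apply: le_trans (le_pow _ (ltW P0R) pq).
  apply: (quotient_le_of_abc heps hK habc k0 P0 Q0 _ gt _ _ P0R y3) => //.
  + by rewrite muln_gt0 k0 expn_gt0 Q0.
  + by move=> r pr; rewrite mulnC; apply: dvd.
  + by rewrite mulr_gt0.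
  + by rewrite natrX.
  + by rewrite distrC (mulrC alpha).
- by case: hcube; apply: cube_ratio Q0 eq.
Qed.
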